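(* Let $s$ and $t$ be relatively prime positive integers, and let $X$ denote the size of a partition chosen uniformly at random from the set of $(s,t)$-core partitions. Then the fourth moment of $X$ about its mean is $$\mathbf{E}\big[(X-\mathbf{E}[X])^4\big]=\frac{1}{4838400}\, s\,t\,(t-1)(s-1)(s+t+1)(s+t)\,P(s,t),$$ where $$P(s,t)=19s^4t^2+38s^3t^3+19s^2t^4-51s^4t-102s^3t^2-102s^2t^3-51st^4+36s^4+72s^3t+108s^2t^2+72st^3+36t^4-33s^2t-33st^2+36s^2+36st+36t^2+120.$$
   Context: A partition is a non-increasing finite sequence of positive integers $\lambda=(\lambda_1,\dots,\lambda_k)$, $k\ge 0$ (the empty partition is allowed); its size is $\lambda_1+\dots+\lambda_k$. Its Ferrers diagram consists of the cells $(i,j)$ with $1\le i\le k$, $1\le j\le\lambda_i$. The hook length of cell $(i,j)$ is $\lambda_i-j+\lambda'_j-i+1$, where $\lambda'$ is the conjugate partition ($\lambda'_j$ = number of $i$ with $\lambda_i\ge j$). A partition is an $s$-core if no cell has hook length equal to $s$, and an $(s,t)$-core partition if it is simultaneously an $s$-core and a $t$-core. For coprime $s,t$ the set of $(s,t)$-core partitions is finite, and it is given the uniform probability distribution. *)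

(* Defs.v *)
From HB Require Import structures.
From mathcomp Require Import all_boot all_order all_algebra finmap.
From mathcomp Require Import boolp classical_sets cardinality.

Set Implicit Arguments.
Unset Strict Implicit.
Unset Printing Implicit Defensive.

Import Order.TTheory GRing.Theory Num.Theory.

Local Open Scope classical_set_scope.

Definition is_part (la : seq nat) : bool := sorted geq la && all (ltn 0) la.

(* Parts, rows and columns are numbered from 1, so [part la i] is only
   meaningful for 1 <= i <= size la. *)
Definition part (la : seq nat) (i : nat) : nat := nth 0 la i.-1.

Definition conj_part (la : seq nat) (j : nat) : nat :=
  count (fun p => j <= p) la.

Definition cell (la : seq nat) (i j : nat) : bool :=
  (1 <= i <= size la) && (1 <= j <= part la i).

(* On a cell of a partition neither subtraction truncates. *)
Definition hook (la : seq nat) (i j : nat) : nat :=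
  (part la i - j) + (conj_part la j - i) + 1.

Definition is_core (s : nat) (la : seq nat) : Prop :=
  forall i j : nat, cell la i j -> hook la i j <> s.

Definition st_cores (s t : nat) : set (seq nat) :=
  [set la | [/\ is_part la, is_core s la & is_core t la]].

Local Open Scope ring_scope.

(* The size of a partition as a rational random variable. *)
Definition part_size (la : seq nat) : rat := (sumn la)%:R.

(* Expectation under the uniform distribution on a finite nonempty set A;
   [fset_set A] is a junk value (the empty set) when A is infinite. *)
Definition unif_expect (T : choiceType) (A : set T) (X : T -> rat) : rat :=
  (\sum_(x <- fset_set A) X x) / (#|` fset_set A|)%:R.

Definition central_moment (T : choiceType) (A : set T) (n : nat)
    (X : T -> rat) : rat :=
  unif_expect A (fun x => (X x - unif_expect A X) ^+ n).

Definition P4 (s t : rat) : rat :=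
  19 * s ^+ 4 * t ^+ 2 + 38 * s ^+ 3 * t ^+ 3 + 19 * s ^+ 2 * t ^+ 4
  - 51 * s ^+ 4 * t - 102 * s ^+ 3 * t ^+ 2 - 102 * s ^+ 2 * t ^+ 3
  - 51 * s * t ^+ 4
  + 36 * s ^+ 4 + 72 * s ^+ 3 * t + 108 * s ^+ 2 * t ^+ 2
  + 72 * s * t ^+ 3 + 36 * t ^+ 4
  - 33 * s ^+ 2 * t - 33 * s * t ^+ 2
  + 36 * s ^+ 2 + 36 * s * t + 36 * t ^+ 2 + 120.

(* 2016 * 2400 = 4838400; a single literal of that size would be expanded
   into a unary natural number. *)
Definition moment4_formula (s t : rat) : rat :=
  1 / (2016 * 2400)
  * (s * t * (t - 1) * (s - 1) * (s + t + 1) * (s + t) * P4 s t).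

(* Main.v *)
Require Import Defs.
From mathcomp Require Import all_boot all_order all_algebra finmap.
From mathcomp Require Import boolp classical_sets cardinality.
From mathcomp Require Import zify ring.

(**
An (s,t)-core is encoded by its set of first-column hook lengths, a finite set of
positive integers closed under subtracting s and t.  Walking through the residue
classes mod s in steps of t and recording the least missing element of each class,
one obtains a sequence z of s naturals with sum t all of whose levels
j t - s (z_0 + ... + z_(j-1)) are nonnegative; the size of the core is a quadratic
function of the levels invariant under rotation of z.  By the cycle lemma exactly one
rotation of every z with sum t has nonnegative levels, so the uniform distribution on
cores may be replaced by the uniform distribution on all s-tuples with sum t.  For
fixed s the average of a polynomial of degree d over these tuples is a polynomial of
degree at most d in t.  Since the moments are symmetric in s and t, this determines
them from their values for small s and t, which are computed by enumeration.
*)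

Set Implicit Arguments.
Unset Strict Implicit.
Unset Printing Implicit Defensive.
Import Order.TTheory GRing.Theory Num.Theory.

(** * Beta-sets and hook lengths *)

(** The first-column hook lengths of a partition, largest first: its beta-set. On strictly
    decreasing lists of positive integers [unbeta] is the inverse, and its subtractions do not
    truncate. *)
Fixpoint beta (la : seq nat) : seq nat :=
  if la is p :: l then (p + size l) :: beta l else [::].

Fixpoint unbeta (B : seq nat) : seq nat :=
  if B is b :: B' then (b - size B') :: unbeta B' else [::].

Lemma size_beta la : size (beta la) = size la.
Proof. by elim: la => //= p l ->. Qed.

Lemma size_unbeta B : size (unbeta B) = size B.
Proof. by elim: B => //= b B ->. Qed.

Lemma is_part_cons p l :
  is_part (p :: l) = [&& 0 < p, all (fun q => q <= p) l & is_part l].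
Proof.
rewrite /is_part /= path_sortedE; last by move=> x y z /= h1 h2; apply: leq_trans h2 h1.
by case: (0 < p); case: (all _ _); case: (sorted _ _); case: (all _ _).
Qed.

Lemma betaK la : unbeta (beta la) = la.
Proof. by elim: la => //= p l ->; rewrite size_beta addnK. Qed.

Lemma sorted_gtn_size_le b B : path gtn b B -> all (ltn 0) (b :: B) -> size B < b.
Proof.
elim: B b => [|c B IH] b /=; first by rewrite andbT.
by move=> /andP[cb hB] /andP[_ /(IH _ hB)] h; apply: leq_ltn_trans cb.
Qed.

Lemma unbetaK B : sorted gtn B -> all (ltn 0) B -> beta (unbeta B) = B.
Proof.
elim: B => //= b B IH hp hb; rewrite size_unbeta subnK.
  by rewrite IH ?(path_sorted hp) //; case/andP: hb.
by apply: ltnW; apply: sorted_gtn_size_le.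
Qed.

Lemma beta_sorted la : is_part la -> sorted gtn (beta la) && all (ltn 0) (beta la).
Proof.
elim: la => // p l IH; rewrite is_part_cons => /and3P[p0 pl /[dup] lp /IH /andP[h1 h2]].
rewrite /= h2 andbT; apply/andP; split; last by lia.
case: l h1 pl {IH lp h2} => //= q l -> /andP[qp _]; rewrite andbT /=; lia.
Qed.

Lemma unbeta_part B : sorted gtn B -> all (ltn 0) B -> is_part (unbeta B).
Proof.
elim: B => // b B IH hp hb; rewrite is_part_cons -/unbeta /=.
have hB : is_part (unbeta B) by apply: IH; [exact: path_sorted hp | case/andP: hb].
rewrite hB andbT subn_gt0 (sorted_gtn_size_le hp hb) /=.
case: B hp hb hB {IH} => //= c B /andP[cb hp] /and3P[_ c0 hB0] hB.
have hc : c - size B <= b - (size B).+1 by move: cb; lia.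
rewrite hc /=; move: hB; rewrite is_part_cons => /and3P[_ /allP h _].
by apply/allP => q /h hq; apply: leq_trans hc.
Qed.

Lemma sumn_beta la : sumn (beta la) = sumn la + 'C(size la, 2).
Proof. by elim: la => //= p l ->; rewrite binS bin1; lia. Qed.

Lemma sorted_gtn_mem b B : path gtn b B -> forall c, c \in B -> c < b.
Proof.
rewrite path_sortedE; last by move=> x y z /= h1 h2; apply: ltn_trans h2 h1.
by case/andP => /allP h _ c /h.
Qed.

(* The numbers [j - 1 + (size la - conj_part la j)], [j >= 1], are exactly the
   naturals missing from the beta-set. *)
Lemma beta_gap la j : is_part la -> 0 < j ->
  j.-1 + size la - conj_part la j \notin beta la.
Proof.
elim: la => // p l IH; rewrite is_part_cons => /and3P[p0 /allP pl lp] j0.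
rewrite /conj_part /= -/(conj_part l j).
have cl : conj_part l j <= size l by apply: count_size.
have h0 : j <= p \/ conj_part l j = 0.
  case: (leqP j p) => hj; [by left | right].
  apply/eqP; rewrite -leqn0 leqNgt -has_count; apply/hasPn => q /pl; lia.
rewrite inE negb_or; apply/andP; split; first by case: (leqP j p) h0; lia.
case: (leqP j p) h0 => hj h0.
  by rewrite (_ : _ - _ = j.-1 + size l - conj_part l j); [exact: IH | lia].
apply/negP => /(sorted_gtn_mem (b := p + size l)) H.
have: path gtn (p + size l) (beta l).
  have /beta_sorted/andP[] // : is_part (p :: l).
  by rewrite is_part_cons p0 lp andbT /=; apply/allP.
by move/H; case: h0; lia.
Qed.

(** Converse of [beta_gap]. Under a new top row [p], a gap with column index [j <= p] keeps its
    index. A gap with [j > p] lies right of the whole diagram, where adding a row shifts the index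
    down by one. *)
Lemma gap_beta la c : is_part la -> c \notin beta la ->
  exists2 j, 0 < j & c + conj_part la j = j.-1 + size la.
Proof.
elim: la => [|p l IH]; first by move=> _ _; exists c.+1; rewrite //= /conj_part /=; lia.
rewrite is_part_cons => /and3P[p0 /allP pl lp].
rewrite inE negb_or => /andP[cp /(IH lp)[j j0 hj]].
have cl : conj_part l j <= size l by apply: count_size.
rewrite /conj_part /=.
case: (leqP j p) => hjp.
  by exists j => //; rewrite hjp -/(conj_part l j); lia.
have h0 : conj_part l j = 0.
  apply/eqP; rewrite -leqn0 leqNgt -has_count; apply/hasPn => q /pl; lia.
have hp1 : p < j.-1 by move: cp hj; rewrite h0; lia.
have h0' : conj_part l j.-1 = 0.
  apply/eqP; rewrite -leqn0 leqNgt -has_count; apply/hasPn => q /pl; lia.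
exists j.-1; first by lia.
by rewrite -/(conj_part l j.-1) h0'; lia.
Qed.

(** Removing the top row preserves all hooks below it: each column that meets a lower row also meets
    the top row, so its height and the row index drop together. *)
Lemma is_core_cons s p l : is_part (p :: l) ->
  is_core s (p :: l) <->
  is_core s l /\ (forall j, 0 < j <= p -> (p - j + conj_part l j).+1 <> s).
Proof.
rewrite is_part_cons => /and3P[p0 /allP pl lp]; split.
  move=> H; split.
    move=> i j /andP[/andP[i0 il] /andP[j0 jp]].
    have hp : j <= p by apply: leq_trans jp _; apply: pl; apply: mem_nth; by rewrite prednK.
    move: (H i.+1 j); rewrite /cell /hook /part /conj_part /=.
    case: i i0 il jp => // i _ il jp; rewrite /= hp.
    move=> H1 H2; apply: H1; first by apply/andP; split; [lia | rewrite j0].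
    by rewrite -H2 /part /conj_part /= subSS.
  move=> j /andP[j0 jp]; move: (H 1 j); rewrite /cell /hook /part /conj_part /= j0 jp.
  by move=> /(_ isT); rewrite -/(conj_part l j); lia.
case=> H1 H2 [|[|i]] j //= /andP[/andP[_ il] /andP[j0 jp]].
  move: (H2 j); rewrite j0 /= => /(_ jp); rewrite /hook /part /conj_part /=.
  by move: jp; rewrite /part /= => ->; rewrite -/(conj_part l j); lia.
have hp : j <= p by apply: leq_trans jp _; apply: pl; apply: mem_nth; move: il => /=; lia.
move: (H1 i.+1 j); rewrite /cell /hook /part /conj_part /=.
rewrite hp; move=> H3 H4; apply: H3; last by rewrite -H4 subSS.
by move: il jp; rewrite /part /= => il ->; rewrite j0 andbT; lia.
Qed.

Definition sub_closed s (B : seq nat) := forall b, b \in B -> s <= b -> b - s \in B.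

(** The hook lengths in the row with beta-number [b] are the differences [b - c] over the gaps
    [c < b]. Hence a hook of length [s] occurs exactly when some [b - s] is a gap. *)
Lemma is_coreP s la : 0 < s -> is_part la -> is_core s la <-> sub_closed s (beta la).
Proof.
move=> s0; elim: la => [|p l IH] hpl; first by split => // _ [|i] j.
have pl : path gtn (p + size l) (beta l) by case/andP: (beta_sorted hpl).
rewrite is_core_cons //; move: (hpl); rewrite is_part_cons => /and3P[p0 /allP lep lp].
rewrite IH //; split.
  case=> H1 H2 b; rewrite inE => /orP[/eqP->|bl] sb; last by rewrite inE H1 ?orbT.
  rewrite inE; apply/orP; right; apply/negP => /negP/(gap_beta lp)[j j0 hj].
  have cl : conj_part l j <= size l by apply: count_size.
  case: (leqP j p) => hjp; first by move: (H2 j); rewrite j0 hjp => /(_ isT); lia.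
  have h0 : conj_part l j = 0.
    apply/eqP; rewrite -leqn0 leqNgt -has_count; apply/hasPn => q /lep; lia.
  lia.
move=> H; split.
  move=> b bl sb; move: (H b); rewrite inE bl orbT => /(_ isT sb).
  by rewrite inE => /orP[/eqP h|//]; have := sorted_gtn_mem pl bl; lia.
move=> j /andP[j0 jp] hs.
have cl : conj_part l j <= size l by apply: count_size.
move: (H (p + size l)); rewrite inE eqxx => /(_ isT) H'.
have /H' : s <= p + size l by lia.
rewrite inE => /orP[/eqP|]; first by lia.
rewrite (_ : _ - _ = j.-1 + size l - conj_part l j); last by lia.
by apply/negP; apply: beta_gap.
Qed.

(** * Cores as sequences with nonnegative levels *)

Fixpoint comps (s t : nat) : seq (seq nat) :=
  if s is s'.+1 then [seq k :: z | k <- iota 0 t.+1, z <- comps s' (t - k)]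
  else if t == 0 then [:: [::]] else [::].

Lemma compsS s t :
  comps s.+1 t = [seq k :: z | k <- iota 0 t.+1, z <- comps s (t - k)].
Proof. by []. Qed.

Lemma mem_comps s t z : (z \in comps s t) = (size z == s) && (sumn z == t).
Proof.
elim: s t z => [|s IH] t z.
  by case: t => [|t]; case: z => //=; rewrite ?inE //; case.
rewrite compsS; apply/allpairsPdep/idP => [[k [y [hk hy ->]]] | ].
  move: hk hy; rewrite mem_iota IH => hk /andP[/eqP <- /eqP h] /=.
  by rewrite eqxx /= h; lia.
case: z => [|k y] //= /andP[hs /eqP ht]; exists k, y; split=> //.
  by rewrite -[_ :: _]/(iota 0 t.+1) mem_iota; lia.
by rewrite IH -ht addKn eqxx andbT -eqSS.
Qed.

Lemma uniq_comps s t : uniq (comps s t).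
Proof.
elim: s t => [|s IH] t; first by rewrite /=; case: ifP.
rewrite compsS.
apply: allpairs_uniq_dep => //; first exact: iota_uniq.
by move=> [k y] [k' y'] _ _ /= [-> ->].
Qed.

Definition psum (z : seq nat) j := sumn (take j z).

(** The rational Dyck condition: the lattice path with column steps [z] stays on one side of the
    diagonal of a [size z] by [sumn z] rectangle. *)
Definition dyck (z : seq nat) : bool :=
  all (fun j => size z * psum z j <= j * sumn z) (iota 0 (size z)).

(* Truncated subtraction: only meaningful when [dyck z] holds. *)
Definition level (z : seq nat) j := j * sumn z - size z * psum z j.

(** Each level is to be the least missing natural of its residue class modulo [size z]; everything
    below it in that class is put into the set. *)
Definition bset (z : seq nat) : seq nat :=
  [seq level z j - size z * i.+1 | j <- iota 0 (size z),
                                   i <- iota 0 (level z j %/ size z)].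

Definition core (z : seq nat) : seq nat := unbeta (sort geq (bset z)).

Lemma psumS z j : psum z j.+1 = psum z j + nth 0 z j.
Proof.
rewrite /psum; case: (ltnP j (size z)) => hj.
  by rewrite (take_nth 0) // sumn_rcons.
by rewrite nth_default // !take_oversize //; lia.
Qed.

Lemma psum_eq z z' : size z = size z' ->
  (forall j, j <= size z -> psum z j = psum z' j) -> z = z'.
Proof.
move=> hs h; apply: (@eq_from_nth _ 0) => // j hj.
by move: (h j.+1 hj) (h j (ltnW hj)); rewrite !psumS; lia.
Qed.

Lemma dyck_level z j : dyck z -> j <= size z ->
  level z j + size z * psum z j = j * sumn z.
Proof.
move=> /allP h; rewrite leq_eqVlt => /orP[/eqP->|hj].
  by rewrite /level /psum take_size subnn.
by rewrite /level subnK //; apply: h; rewrite mem_iota.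
Qed.

Lemma mul_inj_mod s t i j : coprime s t -> i < s -> j < s ->
  i * t = j * t %[mod s] -> i = j.
Proof.
move=> co; wlog ij : i j / i <= j.
  by move=> H hi hj e; case: (leqP i j) => h; [|symmetry]; apply: H => //; exact: ltnW.
move=> hi hj /eqP; rewrite eq_sym eqn_mod_dvd ?leq_mul2r ?ij ?orbT //.
rewrite -mulnBl Gauss_dvdl // => /dvdnP[[|k]]; first by lia.
by rewrite mulSn; lia.
Qed.

Lemma level_mod z j : dyck z -> j <= size z ->
  level z j = j * sumn z %[mod size z].
Proof. by move=> d hj; rewrite -(dyck_level d hj) addnC mulnC modnMDl. Qed.

Lemma mem_bset z b : 0 < size z -> reflect
  (exists j, [/\ j < size z, b < level z j & b = level z j %[mod size z]])
  (b \in bset z).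
Proof.
move=> z0; apply: (iffP allpairsPdep).
  move=> [j [i [hj hi ->]]]; exists j; move: hj hi; rewrite !mem_iota !add0n /= => hj hi.
  have h : size z * i.+1 <= level z j.
    by apply: leq_trans (leq_trunc_div (level z j) (size z)); rewrite mulnC leq_mul2r hi orbT.
  split=> //; first by lia.
  by rewrite -{2}(subnK h) mulnC addnC modnMDl.
move=> [j [hj hb /eqP e]]; exists j, ((level z j - b) %/ size z).-1.
move: e; rewrite eq_sym eqn_mod_dvd ?(ltnW hb) // => /dvdnP[k hk].
have k0 : 0 < k by lia.
rewrite !mem_iota hk mulnK // prednK //; split=> //.
  by rewrite /= add0n leq_divRL //; lia.
by rewrite mulnC; lia.
Qed.

Section Core.
Variable z : seq nat.
Hypotheses (z0 : 0 < size z) (co : coprime (size z) (sumn z)) (dz : dyck z).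

Lemma level_inj i j : i < size z -> j < size z ->
  level z i = level z j %[mod size z] -> i = j.
Proof.
by move=> hi hj; rewrite (level_mod dz (ltnW hi)) (level_mod dz (ltnW hj)); apply: mul_inj_mod.
Qed.

Lemma level0 : level z 0 = 0.
Proof. by rewrite /level mul0n. Qed.

Lemma uniq_bset : uniq (bset z).
Proof.
apply: allpairs_uniq_dep; first exact: iota_uniq.
  by move=> j _; apply: iota_uniq.
move=> [j i] [j' i'] /allpairsPdep[x [y [hx hy [-> ->]]]].
move=> /allpairsPdep[x' [y' [hx' hy' [-> ->]]]] /= e.
move: hx hy hx' hy'; rewrite !mem_iota !add0n /= => hx hy hx' hy'.
have h : size z * y.+1 <= level z x.
  by apply: leq_trans (leq_trunc_div (level z x) (size z)); rewrite mulnC leq_mul2r hy orbT.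
have h' : size z * y'.+1 <= level z x'.
  by apply: leq_trans (leq_trunc_div (level z x') (size z)); rewrite mulnC leq_mul2r hy' orbT.
have ex : x = x'.
  apply: level_inj => //; rewrite -(subnK h) -(subnK h') e.
  by rewrite addnC mulnC modnMDl addnC mulnC modnMDl.
rewrite ex in e h *.
have : size z * y.+1 = size z * y'.+1 by lia.
by move/eqP; rewrite eqn_pmul2l // => /eqP[->].
Qed.

(** Zero could only come from the class of residue 0, which is the class [j = 0]; its level is 0, so
    it contributes nothing. *)
Lemma bset_pos b : b \in bset z -> 0 < b.
Proof.
case: b => // /(mem_bset _ z0)[j [hj h0 e]].
have : 0 = j by apply: level_inj => //; rewrite level0.
by move=> e0; move: h0; rewrite -e0 level0.
Qed.

Lemma sorted_bset : sorted gtn (sort geq (bset z)).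
Proof.
rewrite gtn_sorted_uniq_geq sort_uniq uniq_bset /=.
by apply: sort_sorted => x y; apply: leq_total.
Qed.

Lemma all_bset : all (ltn 0) (sort geq (bset z)).
Proof. by apply/allP => b; rewrite mem_sort => /bset_pos. Qed.

Lemma beta_core : beta (core z) = sort geq (bset z).
Proof. by rewrite unbetaK // ?sorted_bset ?all_bset. Qed.

Lemma sub_closed_bset_size : sub_closed (size z) (bset z).
Proof.
move=> b /(mem_bset _ z0)[j [hj hb e]] hs; apply/(mem_bset _ z0); exists j; split=> //.
  by lia.
by rewrite -e -{2}(subnK hs) modnDr.
Qed.

(** Subtracting [sumn z] moves class [j + 1] to class [j], and [level z j.+1 <= level z j + sumn z],
    so the result stays below the level. Class 0 is empty. *)
Lemma sub_closed_bset_sumn : sub_closed (sumn z) (bset z).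
Proof.
move=> b /(mem_bset _ z0)[j [hj hb e]] hs.
case: j hj hb e => [|j] hj hb e; first by rewrite level0 in hb.
have h1 := dyck_level dz (ltnW hj); have h2 := dyck_level dz (ltnW (ltnW hj)).
apply/(mem_bset _ z0); exists j; split; first by lia.
  by move: h1 h2; rewrite psumS mulnDr mulSn; lia.
apply/eqP; rewrite -(eqn_modDr (sumn z)) subnK // e.
rewrite (level_mod dz (ltnW hj)) eq_sym -modnDml (level_mod dz (ltnW (ltnW hj))) modnDml.
by rewrite mulSn addnC.
Qed.

Lemma core_st_core : 0 < sumn z -> core z \in (st_cores (size z) (sumn z)).
Proof.
move=> t0; rewrite inE; split.
- exact: unbeta_part sorted_bset all_bset.
- apply/is_coreP => //; first exact: unbeta_part sorted_bset all_bset.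
  by rewrite beta_core => b; rewrite !mem_sort; apply: sub_closed_bset_size.
- apply/is_coreP => //; first exact: unbeta_part sorted_bset all_bset.
  by rewrite beta_core => b; rewrite !mem_sort; apply: sub_closed_bset_sumn.
Qed.

End Core.

(** The beta-set determines the least missing element of every class, hence all levels; the levels
    determine the partial sums and so the sequence. *)
Lemma core_inj s t z z' : 0 < s -> coprime s t ->
  z \in comps s t -> z' \in comps s t -> dyck z -> dyck z' ->
  core z = core z' -> z = z'.
Proof.
move=> s0 co; rewrite !mem_comps => /andP[/eqP hs /eqP ht] /andP[/eqP hs' /eqP ht'] d d'.
move=> /(congr1 beta); rewrite !beta_core ?hs ?ht ?hs' ?ht' // => e.
have eB : bset z =i bset z' by move=> b; rewrite -(mem_sort geq) e mem_sort.
suff H y y' : size y = s -> sumn y = t -> size y' = s -> sumn y' = t ->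
   dyck y -> dyck y' -> bset y =i bset y' ->
   forall j, j < s -> level y' j <= level y j.
  apply: psum_eq; rewrite ?hs' // => j; rewrite hs leq_eqVlt => /orP[/eqP->|hj].
    by rewrite /psum -{1}hs -hs' !take_size ht ht'.
  have le : level z j = level z' j.
    by apply/eqP; rewrite eqn_leq !(H z z') ?(H z' z).
  have h1 : j <= size z by rewrite hs ltnW.
  have h2 : j <= size z' by rewrite hs' ltnW.
  move: (dyck_level d h1) (dyck_level d' h2); rewrite le hs hs' ht ht' => <- /addnI /eqP.
  by rewrite eqn_pmul2l // => /eqP.
move=> {}hs {}ht {}hs' {}ht' {}d {}d' {}eB j hj; rewrite leqNgt; apply/negP => h.
(* The number [level y j] lies below [level y' j] in the same class, so it belongs to [bset y'],
   although it is missing from [bset y]. *)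
have : level y j \in bset y'.
  have y0' : 0 < size y' by rewrite hs'.
  apply/(mem_bset _ y0'); rewrite hs'; exists j; split=> //.
  have h1 : j <= size y by rewrite hs ltnW.
  have h2 : j <= size y' by rewrite hs' ltnW.
  by rewrite -{1}hs (level_mod d h1) -hs' (level_mod d' h2) hs hs' ht ht'.
have y0 : 0 < size y by rewrite hs.
rewrite -eB => /(mem_bset _ y0); rewrite hs => -[j' [hj' h' e']].
have ej : j = j' by apply: (@level_inj y); rewrite ?hs ?ht.
by rewrite -ej ltnn in h'.
Qed.

(** * Every core comes from a Dyck sequence *)

Lemma inv_mod s t r : 0 < s -> coprime s t ->
  exists2 j, j < s & j * t = r %[mod s].
Proof.
(* The Chinese remainder theorem gives a multiple of [t] congruent to [r] modulo [s]; its quotient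
   by [t] is reduced modulo [s]. *)
move=> s0 co; exists (chinese s t r 0 %/ t %% s); first exact: ltn_pmod.
have /dvdnP[k hk] : t %| chinese s t r 0.
  by rewrite /dvdn chinese_modr // mod0n.
rewrite modnMml.
(* If [t = 0], coprimality forces [s = 1] and all congruences are trivial. *)
case: (posnP t) => t0.
  by move: co; rewrite t0 /coprime gcdn0 => /eqP ->; rewrite !modn1.
by rewrite {1}hk mulnK // -hk chinese_modl.
Qed.

Lemma mem_leq_sumn c C : c \in C -> c <= sumn C.
Proof.
elim: C => //= b C IH; rewrite inE => /orP[/eqP->|/IH h]; first exact: leq_addr.
exact: leq_trans (leq_addl _ _).
Qed.

Lemma exists_gap s (B : seq nat) r : 0 < s -> exists n, r + s * n \notin B.
Proof.
move=> s0; exists (sumn B).+1; apply/negP => /mem_leq_sumn.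
by case: s s0 => // n _; rewrite mulSn; lia.
Qed.

Section Onto.
Variables (s t : nat) (B : seq nat).
Hypotheses (s0 : 0 < s) (t0 : 0 < t) (co : coprime s t).
Hypotheses (Bs : sub_closed s B) (Bt : sub_closed t B) (B0 : 0 \notin B).

Definition first_gap r := r + s * ex_minn (exists_gap B r s0).

Lemma first_gap_notin r : first_gap r \notin B.
Proof. by rewrite /first_gap; case: ex_minnP. Qed.

Lemma sub_closed_iter r n m : n <= m -> r + s * m \in B -> r + s * n \in B.
Proof.
elim: m => [|m IH]; first by rewrite leqn0 => /eqP->.
rewrite leq_eqVlt => /orP[/eqP->//|nm] /Bs h; apply: IH => //.
by move: h; rewrite mulnS addnCA addKn => /(_ (leq_addr _ _)).
Qed.

(** Closure under subtracting [s] makes [B] an initial segment of each residue class, so its first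
    gap decides membership. *)
Lemma mem_first_gap b : (b \in B) = (b < first_gap (b %% s)).
Proof.
rewrite /first_gap; case: ex_minnP => n hn hmin.
rewrite {1 2}(divn_eq b s) addnC (mulnC _ s) ltn_add2l ltn_pmul2l //.
case: (ltnP (b %/ s) n) => h; last by apply/negP => /(sub_closed_iter h); apply/negP.
by apply/negPn/negP => /hmin; rewrite leqNgt h.
Qed.

Lemma first_gap_mod r : r < s -> first_gap r %% s = r.
Proof. by move=> h; rewrite /first_gap addnC mulnC modnMDl modn_small. Qed.

Lemma first_gap0 : first_gap 0 = 0.
Proof.
apply/eqP; rewrite /first_gap; case: ex_minnP => n _ /(_ 0).
by rewrite muln0 addn0 => /(_ B0); rewrite leqn0 => /eqP->; rewrite muln0.
Qed.

(** First gaps listed along the walk through the classes of 0, [t], [2 t], and so on. *)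
Definition glevel j := first_gap (j * t %% s).

Lemma glevel_mod j : glevel j = j * t %[mod s].
Proof. by rewrite /glevel first_gap_mod // ltn_mod. Qed.

(** Otherwise [glevel j + t] lies below the first gap of its class, hence in [B], and closure under
    subtracting [t] puts the gap [glevel j] into [B]. *)
Lemma glevelS j : glevel j.+1 <= glevel j + t.
Proof.
rewrite leqNgt; apply/negP => h.
have e : (glevel j + t) %% s = (j.+1 * t) %% s.
  by rewrite -modnDml glevel_mod modnDml mulSn addnC.
have : glevel j + t \in B by rewrite mem_first_gap e.
by move=> /Bt /(_ (leq_addl _ _)); rewrite addnK; apply/negP; exact: first_gap_notin.
Qed.

(** Solves [glevel j.+1 = glevel j + t - s * z_j] for [z_j]. The division is exact because both
    sides agree modulo [s], and [glevelS] makes the quotient a natural number. *)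
Definition gseq : seq nat := mkseq (fun j => (glevel j + t - glevel j.+1) %/ s) s.

Lemma gseq_nth j : s * ((glevel j + t - glevel j.+1) %/ s) = glevel j + t - glevel j.+1.
Proof.
rewrite mulnC divnK // -eqn_mod_dvd ?glevelS //.
by rewrite -modnDml !glevel_mod modnDml mulSn addnC.
Qed.

Lemma gseq_psum j : j <= s -> s * psum gseq j + glevel j = j * t.
Proof.
elim: j => [|j IH] hj; first by rewrite /psum take0 /= /glevel mul0n mod0n first_gap0 muln0.
rewrite psumS nth_mkseq // mulnDr gseq_nth mulSn.
by move: (IH (ltnW hj)) (glevelS j); lia.
Qed.

Lemma size_gseq : size gseq = s. Proof. exact: size_mkseq. Qed.

(** After [s] steps the walk is back in the class of 0, whose first gap is 0, so
    [s * sumn gseq = s * t]. *)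
Lemma sumn_gseq : sumn gseq = t.
Proof.
have gs : glevel s = 0 by rewrite /glevel ?modnMl ?modnMr first_gap0.
have := gseq_psum (leqnn s); rewrite gs addn0 /psum -{2}size_gseq take_size => /eqP.
by rewrite eqn_pmul2l // => /eqP.
Qed.

Lemma level_gseq j : j <= s -> level gseq j = glevel j.
Proof. by move=> /gseq_psum; rewrite /level size_gseq sumn_gseq; lia. Qed.

Lemma dyck_gseq : dyck gseq.
Proof.
apply/allP => j; rewrite mem_iota size_gseq sumn_gseq => /andP[_ h].
by move: (gseq_psum (ltnW h)); lia.
Qed.

Lemma bset_gseq : bset gseq =i B.
Proof.
move=> b; rewrite mem_first_gap; have z0 : 0 < size gseq by rewrite size_gseq.
apply/(mem_bset _ z0)/idP; rewrite size_gseq.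
  move=> [j [hj]]; rewrite level_gseq ?(ltnW hj) // => hb e.
  by move: hb; rewrite e glevel_mod.
move=> h; have [j hj e] := inv_mod b s0 co; exists j.
by rewrite level_gseq ?(ltnW hj) // glevel_mod e; split=> //; rewrite /glevel e.
Qed.

End Onto.

Lemma st_core_dyck s t la : 0 < s -> 0 < t -> coprime s t -> la \in st_cores s t ->
  exists2 z, (z \in comps s t) && dyck z & la = core z.
Proof.
move=> s0 t0 co; rewrite inE => -[pa /(is_coreP s0 pa) Bs /(is_coreP t0 pa) Bt].
have /andP[h1 h2] := beta_sorted pa.
have B0 : 0 \notin beta la by apply/negP => /(allP h2).
exists (gseq t (beta la) s0).
  by rewrite mem_comps size_gseq sumn_gseq // dyck_gseq // !eqxx.
rewrite /core -[LHS]betaK; congr unbeta; apply: (irr_sorted_eq (leT := gtn)) => //.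
- by move=> x y w /= h3 h4; exact: ltn_trans h4 h3.
- by move=> x /=; rewrite ltnn.
- by apply: sorted_bset; rewrite ?size_gseq ?sumn_gseq ?dyck_gseq.
- by move=> b; rewrite mem_sort bset_gseq.
Qed.

(** * Size and the cycle lemma *)

Local Open Scope ring_scope.

(** Signed levels, meaningful for every sequence and not only for Dyck ones. *)
Definition rlevel (z : seq nat) j : rat :=
  j%:R * (sumn z)%:R - (size z)%:R * (psum z j)%:R.

(** Half the difference between the variance of the levels and the variance [(s ^ 2 - 1) / 12] of
    [0, ..., s - 1], where [s = size z]. *)
Definition qsize (z : seq nat) : rat :=
  ((size z)%:R * (\sum_(0 <= j < size z) rlevel z j ^+ 2)
     - (\sum_(0 <= j < size z) rlevel z j) ^+ 2) / (2 * (size z)%:R ^+ 2)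
  - ((size z)%:R ^+ 2 - 1) / 24.

Lemma perm_map_iota n (f : nat -> nat) :
  (forall i, (i < n)%N -> (f i < n)%N) ->
  (forall i j, (i < n)%N -> (j < n)%N -> f i = f j -> i = j) ->
  perm_eq [seq f i | i <- iota 0 n] (iota 0 n).
Proof.
move=> fn fi.
have u : uniq [seq f i | i <- iota 0 n].
  by rewrite map_inj_in_uniq ?iota_uniq // => i j; rewrite !mem_iota; apply: fi.
have sub : {subset [seq f i | i <- iota 0 n] <= iota 0 n}.
  by move=> _ /mapP[i hi ->]; move: hi; rewrite !mem_iota !add0n /=; apply: fn.
apply: uniq_perm => //; first exact: iota_uniq.
by apply: (uniq_min_size u sub _).2; rewrite size_map.
Qed.

Lemma bin2_rat n : 'C(n, 2)%:R = n%:R * (n%:R - 1) / 2 :> rat.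
Proof.
elim: n => [|n IH]; first by rewrite !mul0r.
by rewrite binS bin1 natrD IH -[n.+1]addn1 natrD; field.
Qed.

Lemma sum_chain a s :
  (\sum_(i <- iota 0 (a %/ s)) (a - s * i.+1) =
   a %/ s * (a %% s) + s * 'C(a %/ s, 2))%N.
Proof.
have -> : iota 0 (a %/ s) = index_iota 0 (a %/ s) by rewrite /index_iota subn0.
rewrite -bin2_sum big_distrr /=.
have -> : (a %/ s * (a %% s) = \sum_(0 <= i < a %/ s) a %% s)%N.
  by rewrite sum_nat_const_nat subn0.
(* Read backwards, the terms are [a %% s + s * i]. *)
rewrite -big_split big_nat_rev /= !big_nat; apply: eq_bigr => i /andP[_ hi].
rewrite add0n -subSn // subSS {1}(divn_eq a s) mulnC mulnBr.
have : (s * i <= s * (a %/ s))%N by rewrite leq_mul2l (ltnW hi) orbT.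
lia.
Qed.

Lemma sum_iota_rat n (f : nat -> nat) :
  (\sum_(i <- iota 0 n) f i)%N%:R = \sum_(0 <= i < n) (f i)%:R :> rat.
Proof. by rewrite natr_sum /index_iota subn0. Qed.

Lemma sum_id_rat n : \sum_(0 <= i < n) i%:R = n%:R * (n%:R - 1) / 2 :> rat.
Proof. by rewrite -natr_sum bin2_sum bin2_rat. Qed.

Lemma sum_sq_rat n :
  \sum_(0 <= i < n) i%:R ^+ 2 = n%:R * (n%:R - 1) * (2 * n%:R - 1) / 6 :> rat.
Proof.
elim: n => [|n IH]; first by rewrite big_nil !mul0r.
by rewrite big_nat_recr //= IH -[n.+1]addn1 natrD; field.
Qed.

Lemma rlevel_dyck z j : dyck z -> (j <= size z)%N -> (level z j)%:R = rlevel z j.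
Proof. by move=> d hj; rewrite /rlevel -natrM -(dyck_level d hj) natrD natrM addrK. Qed.

(** The size is the sum of the beta-set minus a binomial coefficient in its cardinality. Write each
    level as [s * n j + r j]; the remainders permute [0, ..., s - 1], so their own sums are
    explicit, and the sums involving [n j] match those in the expansion of [qsize]. *)
Lemma part_size_core z : (0 < size z)%N -> coprime (size z) (sumn z) -> dyck z ->
  part_size (core z) = qsize z.
Proof.
move=> z0 co dz; set s := size z in z0 co *.
pose n j := (level z j %/ s)%N; pose r j := (level z j %% s)%N.
have hsum : (sumn (bset z))%:R =
    \sum_(0 <= j < s) ((n j)%:R * (r j)%:R + s%:R * ((n j)%:R * ((n j)%:R - 1) / 2)) :> rat.
  rewrite sumnE big_allpairs_dep /= sum_iota_rat; apply: eq_bigr => j _.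
  by rewrite sum_chain natrD !natrM bin2_rat.
have hsize : (size (bset z))%:R = \sum_(0 <= j < s) (n j)%:R :> rat.
  rewrite -sum1_size big_allpairs_dep /= sum_iota_rat; apply: eq_bigr => j _.
  by rewrite sum1_size size_iota.
have hr : perm_eq [seq r j | j <- iota 0 s] (iota 0 s).
  apply: perm_map_iota => [j _|i j hi hj]; first exact: ltn_pmod.
  exact: level_inj.
have sr (f : nat -> rat) : \sum_(0 <= j < s) f (r j) = \sum_(0 <= j < s) f j.
  by rewrite /index_iota subn0 -(big_map r xpredT) (perm_big _ hr).
have s_n0 : s%:R != 0 :> rat by rewrite pnatr_eq0 -lt0n.
have lvE j : (0 <= j < s)%N -> rlevel z j = (r j)%:R + s%:R * (n j)%:R.
  move=> /andP[_ hj]; rewrite -rlevel_dyck ?(ltnW hj) // {1}(divn_eq (level z j) s).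
  by rewrite addnC natrD natrM [s%:R * _]mulrC.
have h1 : \sum_(0 <= j < s) rlevel z j =
    s%:R * (s%:R - 1) / 2 + s%:R * \sum_(0 <= j < s) (n j)%:R.
  rewrite (eq_big_nat _ _ lvE) big_split /= mulr_sumr; congr (_ + _).
  by rewrite (sr (fun i => i%:R)) sum_id_rat.
have h2 : \sum_(0 <= j < s) rlevel z j ^+ 2 =
    s%:R * (s%:R - 1) * (2 * s%:R - 1) / 6
    + 2 * s%:R * (\sum_(0 <= j < s) (n j)%:R * (r j)%:R)
    + s%:R ^+ 2 * \sum_(0 <= j < s) (n j)%:R ^+ 2.
  rewrite -sum_sq_rat -(sr (fun i => i%:R ^+ 2)) !mulr_sumr -!big_split /=.
  by apply: eq_big_nat => j /lvE ->; ring.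
have h3 : (sumn (bset z))%:R = \sum_(0 <= j < s) (n j)%:R * (r j)%:R
    + s%:R / 2 * \sum_(0 <= j < s) (n j)%:R ^+ 2
    - s%:R / 2 * \sum_(0 <= j < s) (n j)%:R :> rat.
  rewrite hsum !mulr_sumr -sumrN -!big_split /=.
  by apply: eq_bigr => j _; field.
have hb : (sumn (bset z))%:R = part_size (core z) + 'C(size (bset z), 2)%:R.
  rewrite /part_size -natrD; congr (_%:R).
  have := sumn_beta (core z); rewrite beta_core // -size_beta beta_core // size_sort => <-.
  by rewrite !sumnE; apply/esym/perm_big; rewrite perm_sort.
have -> : part_size (core z) = (sumn (bset z))%:R - 'C(size (bset z), 2)%:R.
  by rewrite hb addrK.
rewrite h3 bin2_rat hsize /qsize -/s h1 h2; field.
by [].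
Qed.

(** * Rotations of a sequence *)

Lemma psum_rot z i j : (i <= size z)%N -> (j <= size z)%N ->
  (psum (rot j z) i + psum z j =
   if i + j <= size z then psum z (i + j) else psum z (i + j - size z) + sumn z)%N.
Proof.
move=> hi hj; rewrite /psum /rot take_cat size_drop.
have e : sumn z = (sumn (take j z) + sumn (drop j z))%N by rewrite -sumn_cat cat_take_drop.
case: ltnP => h.
  have -> : (i + j <= size z)%N by lia.
  by rewrite (addnC i j) takeD sumn_cat addnC.
rewrite sumn_cat take_takel; last by lia.
have e1 : (i - (size z - j) = i + j - size z)%N by lia.
rewrite e1 e; case: leqP => h'; last by lia.
have -> : (i + j - size z = 0)%N by lia.
have -> : (i + j = size z)%N by lia.
by rewrite take_size take0 /=; lia.
Qed.

(** Rotation restarts the walk at position [j]. The signed level vanishes at both ends of the walk,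
    so it extends periodically and the wrap-around adds no correction. *)
Lemma rlevel_rot z i j : (i < size z)%N -> (j < size z)%N ->
  rlevel (rot j z) i = rlevel z ((i + j) %% size z) - rlevel z j.
Proof.
move=> hi hj; rewrite /rlevel size_rot.
have -> : sumn (rot j z) = sumn z by rewrite !sumnE; apply: perm_big; rewrite perm_rot.
have := psum_rot (ltnW hi) (ltnW hj).
case: leqP => h /(congr1 (fun n => n%:R : rat)); rewrite natrD.
  move: h; rewrite leq_eqVlt => /orP[/eqP h|h].
    rewrite h modnn /psum take_size take0 /= -/(psum _ _) -/(psum z j) => e.
    have -> : (psum (rot j z) i)%:R = (sumn z)%:R - (psum z j)%:R :> rat by rewrite -e addrK.
    have -> : i%:R = (size z)%:R - j%:R :> rat by rewrite -h natrD addrK.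
    by ring.
  rewrite modn_small // => e.
  have -> : (psum (rot j z) i)%:R = (psum z (i + j))%:R - (psum z j)%:R :> rat.
    by rewrite -e addrK.
  by rewrite natrD; ring.
have hm : ((i + j) %% size z = i + j - size z)%N.
  rewrite -{1}(subnK (ltnW h)) modnDr modn_small //; lia.
rewrite hm natrD => e.
have -> : (psum (rot j z) i)%:R =
    (psum z (i + j - size z))%:R + (sumn z)%:R - (psum z j)%:R :> rat by rewrite -e addrK.
by rewrite natrB ?(ltnW h) // natrD; ring.
Qed.

(** A rotation permutes the levels and shifts them by a constant, which leaves their variance
    unchanged. *)
Lemma qsize_rot z j : (j < size z)%N -> qsize (rot j z) = qsize z.
Proof.
move=> hj; rewrite /qsize size_rot; set s := size z.
have hp : perm_eq [seq ((i + j) %% s)%N | i <- iota 0 s] (iota 0 s).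
  apply: perm_map_iota => [i hi|i k hi hk /eqP].
    by rewrite ltn_pmod //; apply: leq_ltn_trans hj.
  by rewrite eqn_modDr !modn_small // => /eqP.
have sr (f : nat -> rat) : \sum_(0 <= i < s) f ((i + j) %% s)%N = \sum_(0 <= i < s) f i.
  by rewrite /index_iota subn0 -(big_map (fun i => (i + j) %% s)%N xpredT) (perm_big _ hp).
have lvE i : (0 <= i < s)%N -> rlevel (rot j z) i = rlevel z ((i + j) %% s) - rlevel z j.
  by move=> /andP[_ hi]; apply: rlevel_rot.
have h1 : \sum_(0 <= i < s) rlevel (rot j z) i =
    \sum_(0 <= i < s) rlevel z i - s%:R * rlevel z j.
  rewrite (eq_big_nat _ _ lvE) big_split /= (sr (rlevel z)); congr (_ + _).
  by rewrite sumr_const_nat subn0 mulNrn mulr_natl.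
have h2 : \sum_(0 <= i < s) rlevel (rot j z) i ^+ 2 =
    \sum_(0 <= i < s) rlevel z i ^+ 2 - 2 * rlevel z j * (\sum_(0 <= i < s) rlevel z i)
    + s%:R * rlevel z j ^+ 2.
  rewrite -(sr (fun i => rlevel z i ^+ 2)) -[in X in _ - X](sr (rlevel z)).
  have -> : s%:R * rlevel z j ^+ 2 = \sum_(0 <= i < s) rlevel z j ^+ 2.
    by rewrite sumr_const_nat subn0 mulr_natl.
  rewrite mulr_sumr -sumrN -!big_split /=.
  by apply: eq_big_nat => i /lvE ->; ring.
congr (_ / _ - _); rewrite h1 h2; ring.
Qed.

Lemma dyckP z : reflect (forall i, (i < size z)%N -> 0 <= rlevel z i) (dyck z).
Proof.
apply: (iffP allP) => h i hi.
  by rewrite /rlevel subr_ge0 -!natrM ler_nat; apply: h; rewrite mem_iota.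
by move: hi; rewrite mem_iota => /andP[_ /h]; rewrite /rlevel subr_ge0 -!natrM ler_nat.
Qed.

Lemma dyck_rotP z j : (j < size z)%N ->
  reflect (forall i, (i < size z)%N -> rlevel z j <= rlevel z i) (dyck (rot j z)).
Proof.
move=> hj; have s0 : (0 < size z)%N by apply: leq_ltn_trans hj.
apply: (iffP (dyckP _)); rewrite size_rot => h i hi.
  (* This index is the one that the cyclic shift by [j] sends to [i]. *)
  have := h ((i + (size z - j)) %% size z)%N; rewrite ltn_pmod // => /(_ isT).
  rewrite rlevel_rot ?ltn_pmod // modnDml -addnA subnK ?(ltnW hj) // modnDr modn_small //.
  by rewrite subr_ge0.
by rewrite rlevel_rot // subr_ge0 h // ltn_pmod.
Qed.

Lemma rlevel_inj z i j : coprime (size z) (sumn z) -> (i < size z)%N -> (j < size z)%N ->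
  rlevel z i = rlevel z j -> i = j.
Proof.
move=> co hi hj e; apply: (mul_inj_mod co hi hj).
have : (i%:R * (sumn z)%:R + (size z)%:R * (psum z j)%:R =
        j%:R * (sumn z)%:R + (size z)%:R * (psum z i)%:R :> rat).
  by move: e; rewrite /rlevel => /eqP; rewrite subr_eq addrAC eq_sym subr_eq => /eqP.
rewrite -!natrM -!natrD => /eqP; rewrite eqr_nat => /eqP.
rewrite ![(size z * _)%N]mulnC => /(congr1 (modn^~ (size z))).
by rewrite addnC modnMDl addnC modnMDl.
Qed.

(** A rotation is Dyck exactly when it starts at a minimal level. Coprimality makes the levels
    pairwise distinct, so the minimum is attained once. *)
Lemma cycle_lemma z : (0 < size z)%N -> coprime (size z) (sumn z) ->
  (\sum_(0 <= j < size z | dyck (rot j z)) 1 = 1)%N.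
Proof.
move=> s0 co.
have [j hj jmin] : exists2 j, (j < size z)%N &
    forall i, (i < size z)%N -> rlevel z j <= rlevel z i.
  pose o : 'I_(size z) := Ordinal s0.
  case: (@Order.TotalTheory.arg_minP _ _ _ o xpredT (fun i : 'I__ => rlevel z i) isT) => k _ hk.
  by exists k => // i hi; apply: (hk (Ordinal hi)).
rewrite big_mkcond (bigD1_seq j) /= ?mem_index_iota ?iota_uniq //.
have -> : dyck (rot j z) by apply/dyck_rotP.
rewrite big1_seq // => i /andP[ij]; rewrite mem_index_iota => /andP[_ hi].
case: ifP => // /(dyck_rotP hi) h; case/negP: ij; apply/eqP.
by apply: (rlevel_inj co) => //; apply/eqP; rewrite eq_le h //= jmin.
Qed.

Lemma perm_comps_rot s t j : perm_eq [seq rot j z | z <- comps s t] (comps s t).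
Proof.
have hs z : sumn (rot j z) = sumn z by rewrite !sumnE; apply: perm_big; rewrite perm_rot.
apply: uniq_perm; first by rewrite map_inj_uniq ?uniq_comps //; apply: rot_inj.
  exact: uniq_comps.
move=> z; apply/mapP/idP => [[y hy ->]|hz].
  by move: hy; rewrite !mem_comps size_rot hs.
exists (rotr j z); last by rewrite rotrK.
by move: hz; rewrite !mem_comps -{1 2}(rotrK j z) size_rot hs.
Qed.

(** Double counting of pairs [(z, j)] with [rot j z] Dyck: each [z] has one such [j], while each
    fixed [j] permutes the sequences and yields the full Dyck sum. *)
Lemma sum_comps_dyck s t (f : seq nat -> rat) : (0 < s)%N -> coprime s t ->
  (forall z j, z \in comps s t -> (j < s)%N -> f (rot j z) = f z) ->
  \sum_(z <- comps s t) f z = s%:R * \sum_(z <- comps s t | dyck z) f z.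
Proof.
move=> s0 co fr.
transitivity (\sum_(z <- comps s t) \sum_(0 <= j < s | dyck (rot j z)) f (rot j z)).
  rewrite !big_seq; apply: eq_bigr => z hz; move: (hz).
  rewrite mem_comps => /andP[/eqP hs /eqP ht].
  transitivity (\sum_(0 <= j < s | dyck (rot j z)) f z).
    have := cycle_lemma (z := z); rewrite hs ht => /(_ s0 co) h1.
    rewrite -[LHS]mulr1 -[1 in LHS]/(1%N%:R) -h1 natr_sum mulr_sumr.
    by apply: eq_bigr => j _; rewrite mulr1.
  rewrite big_nat_cond [RHS]big_nat_cond; apply: eq_bigr => j /andP[/andP[_ hj] _].
  by rewrite fr.
rewrite (exchange_big_dep xpredT) //=.
transitivity (\sum_(0 <= j < s) \sum_(z <- comps s t | dyck z) f z); last first.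
  by rewrite sumr_const_nat subn0 mulr_natl.
apply: eq_bigr => j _.
by rewrite -(big_map (rot j) dyck f) (perm_big _ (perm_comps_rot s t j)).
Qed.

Lemma qsize_comps_rot s t z j : z \in comps s t -> (j < s)%N ->
  qsize (rot j z) = qsize z.
Proof. by rewrite mem_comps => /andP[/eqP <- _]; apply: qsize_rot. Qed.

(** * Expectations over cores as averages over sequences *)

Section Expectation.
Variables s t : nat.
Hypotheses (s0 : (0 < s)%N) (t0 : (0 < t)%N) (co : coprime s t).

Lemma st_coresE :
  st_cores s t = [set` [seq core z | z <- comps s t & dyck z]]%classic.
Proof.
apply/seteqP; split=> la.
  move=> /mem_set /(st_core_dyck s0 t0 co)[z /andP[hz dz] ->] /=.
  by apply: map_f; rewrite mem_filter dz.
move=> /mapP[z]; rewrite mem_filter mem_comps => /andP[dz /andP[/eqP hs /eqP ht]] ->.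
by apply: set_mem; rewrite -hs -ht; apply: core_st_core; rewrite ?hs ?ht.
Qed.

Lemma finite_st_cores : finite_set (st_cores s t).
Proof. by rewrite st_coresE; apply: finite_seq. Qed.

Lemma perm_st_cores :
  perm_eq (fset_set (st_cores s t)) [seq core z | z <- comps s t & dyck z].
Proof.
apply: uniq_perm => //.
  rewrite map_inj_in_uniq ?filter_uniq ?uniq_comps // => z z'.
  rewrite !mem_filter => /andP[d hz] /andP[d' hz']; exact: (core_inj s0 co).
move=> la; rewrite in_fset_set; last exact: finite_st_cores.
by rewrite st_coresE; apply/idP/idP => [/set_mem|h]; [|exact: mem_set].
Qed.

Lemma sum_st_cores (g : rat -> rat) :
  s%:R * \sum_(la <- fset_set (st_cores s t)) g (part_size la) =
  \sum_(z <- comps s t) g (qsize z).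
Proof.
rewrite (perm_big _ perm_st_cores) /= big_map big_filter.
rewrite [RHS](sum_comps_dyck s0 co).
  rewrite big_seq_cond [in RHS]big_seq_cond; congr (_ * _); apply: eq_bigr => z.
  rewrite mem_comps => /andP[/andP[/eqP hs /eqP ht] dz].
  by rewrite part_size_core ?hs ?ht.
by move=> z j hz hj; rewrite (qsize_comps_rot hz).
Qed.

Lemma card_st_cores :
  s%:R * (#|` fset_set (st_cores s t)|)%:R = (size (comps s t))%:R :> rat.
Proof.
have := sum_st_cores (fun=> 1); rewrite !big_const_seq !count_predT !iter_addr_0.
by [].
Qed.

Lemma unif_expect_st_cores (g : rat -> rat) :
  unif_expect (st_cores s t) (fun la => g (part_size la)) =
  (\sum_(z <- comps s t) g (qsize z)) / (size (comps s t))%:R.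
Proof.
rewrite /unif_expect -sum_st_cores -card_st_cores -mulf_div divff ?mul1r //.
by rewrite pnatr_eq0 -lt0n.
Qed.

End Expectation.

(** * Averages of polynomials over the sequences with given sum *)

(** Products of binomial coefficients replace monomials in the entries, because each of them sums
    over [comps] to a single binomial coefficient. *)
Fixpoint binprod (a z : seq nat) : nat :=
  match a, z with
  | k :: a', x :: z' => ('C(x, k) * binprod a' z')%N
  | _, _ => 1%N
  end.

Lemma binprod_nseq0 n z : binprod (nseq n 0%N) z = 1%N.
Proof. by elim: n z => [|n IH] [|x z] //=; rewrite IH bin0. Qed.

(** One factor changes, through [x * 'C(x, k) = k.+1 * 'C(x, k.+1) + k * 'C(x, k)]. *)
Lemma binprod_incr i a z : size a = size z -> (i < size z)%N ->
  (nth 0 z i * binprod a z =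
   (nth 0 a i).+1 * binprod (incr_nth a i) z + nth 0 a i * binprod a z)%N.
Proof.
elim: z a i => [|x z IH] [|k a] [|i] //= [hs] hi; last first.
  by rewrite mulnCA (IH a i hs hi) mulnDr !(mulnCA 'C(x, k)).
have -> : (x * ('C(x, k) * binprod a z) = x * 'C(x, k) * binprod a z)%N by rewrite mulnA.
rewrite !mulnA -mulnDl; congr (_ * _)%N.
rewrite mul_bin_left -mulnDl.
case: (leqP k x) => h; first by rewrite subnK.
by rewrite bin_small ?muln0.
Qed.

Lemma size_incr i a : (i < size a)%N -> size (incr_nth a i) = size a.
Proof. by move=> h; rewrite size_incr_nth h. Qed.

Lemma sumn_incr i a : (i < size a)%N -> sumn (incr_nth a i) = (sumn a).+1.
Proof.
elim: a i => [|k a IH] [|i] //= h.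
by rewrite IH // addnS.
Qed.

(** Induction on [n] with Pascal's rule on the second factor; the case [q = 0] is the hockey-stick
    identity. *)
Lemma Vandermonde_upper n p q :
  (\sum_(0 <= k < n.+1) 'C(k, p) * 'C(n - k, q) = 'C(n.+1, (p + q).+1))%N.
Proof.
elim: n q => [|n IH] q.
  by rewrite big_nat1; case: p => [|p]; case: q => [|q] //; rewrite !bin0n ?bin_small ?muln0.
case: q => [|q].
  rewrite addn0; transitivity (\sum_(0 <= k < n.+2) 'C(k, p))%N.
    by apply: eq_bigr => k _; rewrite bin0 muln1.
  elim: n.+2 => [|m IHm]; first by rewrite big_nil.
  by rewrite big_nat_recr //= IHm binS addnC.
rewrite big_nat_recr //= subnn muln0 addn0.
rewrite (eq_big_nat _ _ (F2 := fun k =>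
  ('C(k, p) * 'C(n - k, q.+1) + 'C(k, p) * 'C(n - k, q))%N)).
  by rewrite big_split /= !IH [RHS]binS addnS addnC.
by move=> k /andP[_ hk]; rewrite subSn // binS mulnDr.
Qed.

Lemma sum_binprod s t a : size a = s.+1 ->
  (\sum_(z <- comps s.+1 t) binprod a z = 'C(t + s, s + sumn a))%N.
Proof.
elim: s t a => [|s IH] t [|k a] // [hs]; rewrite compsS big_allpairs_dep.
  case: a hs => // _; rewrite -[iota 0 _]/(index_iota 0 t.+1) big_nat_recr //= subnn.
  rewrite big_nat big1 => [|j /andP[_ hj]]; last first.
    by rewrite (_ : (t - j == 0)%N = false) ?big_nil //; lia.
  by rewrite /= big_seq1 !addn0 muln1 add0n.
rewrite -[iota 0 _]/(index_iota 0 t.+1) /=.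
transitivity (\sum_(0 <= j < t.+1) 'C(j, k) * 'C(t + s - j, s + sumn a))%N.
  apply: eq_big_nat => j /andP[_ hj].
  by rewrite -big_distrr IH // addnBAC //; lia.
have -> : ('C(t + s.+1, s.+1 + (k + sumn a)) = 'C((t + s).+1, (k + (s + sumn a)).+1))%N.
  by rewrite addnS addSn; congr ('C(_, _.+1)); lia.
(* The terms with [j > t] vanish, since then [t + s - j < s]. *)
rewrite -Vandermonde_upper [RHS](big_cat_nat (n := t.+1)) //=; last by lia.
rewrite [X in _ = (_ + X)%N]big_nat [X in _ = (_ + X)%N]big1 ?addn0 // => j /andP[h1 h2].
by rewrite [X in (_ * X)%N]bin_small ?muln0 //; lia.
Qed.

Lemma size_comps s t : size (comps s.+1 t) = 'C(t + s, s).
Proof.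
have := sum_binprod t (size_nseq s.+1 0%N).
rewrite sumn_nseq mul0n addn0 => <-; rewrite -sum1_size.
by apply: eq_bigr => z _; rewrite binprod_nseq0.
Qed.

(** Raising the lower index from [s + m] to [s + m + 1] multiplies the binomial by
    [(t - m) / (s + m + 1)], one linear factor in [t]. For [t < m] both sides are 0. *)
Lemma bin_ratio s m : exists2 g : {poly rat}, (size g <= m.+1)%N &
  forall t, 'C(t + s, s + m)%:R = 'C(t + s, s)%:R * g.[t%:R].
Proof.
elim: m => [|m [g hg IH]].
  by exists 1 => [|t]; rewrite ?size_poly1 // addn0 hornerC mulr1.
exists ((s + m).+1%:R^-1 *: (g * ('X - m%:R%:P))).
  apply: leq_trans (size_scale_leq _ _) _; apply: leq_trans (size_polyMleq _ _) _.
  by rewrite size_XsubC addn2.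
move=> t; rewrite hornerZ hornerM hornerXsubC mulrCA (mulrA 'C(t + s, s)%:R) -IH.
have n0 : (s + m).+1%:R != 0 :> rat by rewrite pnatr_eq0.
apply: (mulfI n0); rewrite mulVKf // addnS -natrM mul_bin_left.
case: (leqP m t) => h.
  by rewrite natrM (_ : _ - _ = t - m)%N; [rewrite natrB // mulrC | lia].
by rewrite bin_small ?muln0 ?mul0r //; lia.
Qed.

(** Polynomials of degree at most [d] in [s] entries, as the span of the binomial products. The last
    constructor identifies functions that agree on sequences of length [s]. *)
Inductive polyfun (s d : nat) : (seq nat -> rat) -> Prop :=
| Polyfun_bin a : size a = s -> (sumn a <= d)%N ->
    polyfun s d (fun z => (binprod a z)%:R)
| Polyfun_lin c p q : polyfun s d p -> polyfun s d q ->
    polyfun s d (fun z => c * p z + q z)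
| Polyfun_ext p q : (forall z, size z = s -> p z = q z) ->
    polyfun s d p -> polyfun s d q.

Lemma polyfun0 s d : polyfun s d (fun=> 0).
Proof.
have h : polyfun s d (fun z => (binprod (nseq s 0%N) z)%:R).
  by apply: Polyfun_bin; rewrite ?size_nseq // sumn_nseq mul0n.
apply: Polyfun_ext (Polyfun_lin (-1) h h) => z _.
by rewrite mulN1r addNr.
Qed.

Lemma polyfun_scale s d c p : polyfun s d p -> polyfun s d (fun z => c * p z).
Proof.
move=> h; apply: Polyfun_ext (Polyfun_lin c h (polyfun0 s d)) => z _.
by rewrite addr0.
Qed.

Lemma polyfun_add s d p q :
  polyfun s d p -> polyfun s d q -> polyfun s d (fun z => p z + q z).
Proof.
by move=> hp hq; apply: Polyfun_ext (Polyfun_lin 1 hp hq) => z _; rewrite mul1r.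
Qed.

Lemma polyfun_mono s d e p : (d <= e)%N -> polyfun s d p -> polyfun s e p.
Proof.
move=> de; elim=> [a ha hd|c p1 q1 _ h1 _ h2|p1 q1 e1 _ h1].
- by apply: Polyfun_bin => //; apply: leq_trans de.
- exact: Polyfun_lin.
- exact: Polyfun_ext h1.
Qed.

Lemma polyfun_mul_nth s d i p : (i < s)%N -> polyfun s d p ->
  polyfun s d.+1 (fun z => (nth 0%N z i)%:R * p z).
Proof.
move=> hi; elim=> [a ha hd|c p1 q1 _ h1 _ h2|p1 q1 e1 _ h1].
- have h1 : polyfun s d.+1 (fun z => (binprod (incr_nth a i) z)%:R).
    by apply: Polyfun_bin; rewrite ?size_incr ?sumn_incr ?ha.
  have h2 : polyfun s d.+1 (fun z => (binprod a z)%:R).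
    by apply: Polyfun_bin => //; apply: leqW.
  apply: Polyfun_ext (Polyfun_lin (nth 0%N a i).+1%:R h1 (polyfun_scale (nth 0%N a i)%:R h2)).
  by move=> z hz; rewrite -!natrM -natrD binprod_incr ?ha ?hz.
- by apply: Polyfun_ext (Polyfun_lin c h1 h2) => z _; rewrite mulrDr mulrCA.
- by apply: Polyfun_ext h1 => z hz; rewrite e1.
Qed.

Lemma polyfun_sum s d p : polyfun s.+1 d p ->
  exists2 g : {poly rat}, (size g <= d.+1)%N &
    forall t, \sum_(z <- comps s.+1 t) p z = (size (comps s.+1 t))%:R * g.[t%:R].
Proof.
elim=> [a ha hd|c p1 q1 _ [g1 s1 h1] _ [g2 s2 h2]|p1 q1 e1 _ [g sg hg]].
- have [g sg hg] := bin_ratio s (sumn a); exists g; first by apply: leq_trans sg _.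
  by move=> t; rewrite size_comps -hg -sum_binprod // natr_sum.
- exists (c *: g1 + g2).
    apply: leq_trans (size_polyD _ _) _; rewrite geq_max s2 andbT.
    exact: leq_trans (size_scale_leq _ _) s1.
  move=> t; rewrite big_split /= -mulr_sumr h1 h2 hornerD hornerZ mulrDr.
  by rewrite mulrCA.
- exists g => // t; rewrite -hg; rewrite !big_seq; apply: eq_bigr => z.
  by rewrite mem_comps => /andP[/eqP /e1 -> _].
Qed.

(* [f] is a polynomial of degree at most [k], phrased through multiplication so
   that closure under products is immediate. *)
Definition raises s k (f : seq nat -> rat) :=
  forall d p, polyfun s d p -> polyfun s (d + k) (fun z => f z * p z).

Lemma raises_nth s i : (i < s)%N -> raises s 1 (fun z => (nth 0%N z i)%:R).
Proof. by move=> hi d p hp; rewrite addn1; apply: polyfun_mul_nth. Qed.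

Lemma raises_ext s k f g : (forall z, size z = s -> f z = g z) ->
  raises s k f -> raises s k g.
Proof.
by move=> e h d p /h; apply: Polyfun_ext => z hz; rewrite e.
Qed.

Lemma raises_cst s k c : raises s k (fun=> c).
Proof. by move=> d p hp; apply: polyfun_scale; apply: polyfun_mono hp; apply: leq_addr. Qed.

Lemma raises_add s k f g : raises s k f -> raises s k g ->
  raises s k (fun z => f z + g z).
Proof.
move=> hf hg d p hp.
by apply: Polyfun_ext (polyfun_add (hf _ _ hp) (hg _ _ hp)) => z _; rewrite mulrDl.
Qed.

Lemma raises_mul s k l f g : raises s k f -> raises s l g ->
  raises s (k + l) (fun z => f z * g z).
Proof.
move=> hf hg d p hp; rewrite (addnC k) addnA.
by apply: Polyfun_ext (hf _ _ (hg _ _ hp)) => z _; rewrite mulrA.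
Qed.

Lemma raises_scale s k c f : raises s k f -> raises s k (fun z => c * f z).
Proof. by move=> h; apply: (raises_mul (@raises_cst s 0 c) h). Qed.

Lemma raises_sub s k f g : raises s k f -> raises s k g ->
  raises s k (fun z => f z - g z).
Proof.
move=> hf hg; apply: raises_ext (raises_add hf (raises_scale (-1) hg)) => z _.
by rewrite mulN1r.
Qed.

Lemma raises_exp s k n f : raises s k f -> raises s (k * n) (fun z => f z ^+ n).
Proof.
move=> hf; elim: n => [|n IH].
  by rewrite muln0; apply: raises_cst.
by rewrite mulnS; apply: raises_ext (raises_mul hf IH) => z _; rewrite exprS.
Qed.

Lemma raises_sum s k n (F : nat -> seq nat -> rat) :
  (forall i, (i < n)%N -> raises s k (F i)) ->
  raises s k (fun z => \sum_(0 <= i < n) F i z).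
Proof.
elim: n => [|n IH] h.
  by apply: raises_ext (@raises_cst s k 0) => z _; rewrite big_nil.
apply: raises_ext (raises_add (IH _) (h n _)) => // [z _|i hi].
  by rewrite big_nat_recr.
by apply: h; apply: leqW.
Qed.

Lemma psum_sum z j : psum z j = (\sum_(0 <= i < j) nth 0 z i)%N.
Proof.
elim: j => [|j IH]; first by rewrite big_nil /psum take0.
by rewrite psumS IH big_nat_recr.
Qed.

Lemma raises_psum s j : (j <= s)%N -> raises s 1 (fun z => (psum z j)%:R).
Proof.
move=> hj.
have h : raises s 1 (fun z => \sum_(0 <= i < j) (nth 0%N z i)%:R).
  by apply: raises_sum => i hi; apply: raises_nth; apply: leq_trans hj.
by apply: raises_ext h => z _; rewrite psum_sum natr_sum.
Qed.

Lemma raises_sumn s : raises s 1 (fun z => (sumn z)%:R).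
Proof.
by apply: raises_ext (raises_psum (leqnn s)) => z <-; rewrite /psum take_size.
Qed.

Lemma raises_rlevel s j : (j < s)%N -> raises s 1 (fun z => rlevel z j).
Proof.
move=> hj.
apply: raises_ext (raises_sub (raises_scale j%:R (@raises_sumn s))
  (raises_scale s%:R (raises_psum (ltnW hj)))) => z hz.
by rewrite /rlevel hz.
Qed.

Lemma raises_qsize s : raises s 2 qsize.
Proof.
have h1 : raises s 1 (fun z => \sum_(0 <= j < s) rlevel z j).
  by apply: raises_sum => j; apply: raises_rlevel.
have h2 : raises s 2 (fun z => \sum_(0 <= j < s) rlevel z j ^+ 2).
  by apply: raises_sum => j hj; apply: (raises_exp 2 (raises_rlevel hj)).
apply: raises_ext (raises_sub (raises_scale (2 * s%:R ^+ 2)^-1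
  (raises_sub (raises_scale s%:R h2) (raises_exp 2 h1)))
  (@raises_cst s 2 ((s%:R ^+ 2 - 1) / 24))) => z hz.
by rewrite /qsize hz [X in X - _]mulrC.
Qed.

(** Apply [raises] to the constant 1, which is the binomial product of degree 0. *)
Lemma raises_avg s k f : raises s.+1 k f ->
  exists2 g : {poly rat}, (size g <= k.+1)%N &
    forall t, \sum_(z <- comps s.+1 t) f z = (size (comps s.+1 t))%:R * g.[t%:R].
Proof.
move=> h; apply: polyfun_sum.
have h1 : polyfun s.+1 0 (fun z => (binprod (nseq s.+1 0%N) z)%:R).
  by apply: Polyfun_bin; rewrite ?size_nseq // sumn_nseq mul0n.
by apply: Polyfun_ext (h _ _ h1) => z _; rewrite binprod_nseq0 mulr1.
Qed.

(** * Interpolation *)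

(** Armstrong's value for the average size of an (s,t)-core. *)
Definition mean (s t : rat) : rat := (s - 1) * (t - 1) * (s + t + 1) / 24.

Lemma poly_eq_nat (g h : {poly rat}) (xs : seq nat) :
  uniq xs -> (size g <= size xs)%N -> (size h <= size xs)%N ->
  (forall x, x \in xs -> g.[x%:R] = h.[x%:R]) -> g = h.
Proof.
move=> u sg sh e; apply/eqP; rewrite -subr_eq0; apply/eqP.
apply: (@roots_geq_poly_eq0 _ _ [seq x%:R | x <- xs]).
- by apply/allP => _ /mapP[x hx ->]; rewrite rootE !hornerE e // subrr.
- by rewrite map_inj_uniq // => x y /eqP; rewrite eqr_nat => /eqP.
- rewrite size_map; apply: leq_trans (size_polyD _ _) _.
  by rewrite size_polyN geq_max sg.
Qed.

(* If [s] is coprime to all of [1..d], the values [G s 1 .. G s d] are known by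
   symmetry and determine the polynomial [G s]; every [G s] is then determined by
   its values at the infinitely many [t] congruent to [1] modulo [d! * s]. *)
Lemma symmetric_interpolation d (G F : nat -> nat -> rat) :
  (forall s t, G s t = G t s) -> (forall s t, F s t = F t s) ->
  (forall s, (0 < s)%N -> exists2 g : {poly rat}, (size g <= d)%N &
     forall t, (0 < t)%N -> coprime s t -> G s t = g.[t%:R]) ->
  (forall s, exists2 h : {poly rat}, (size h <= d)%N & forall t, F s t = h.[t%:R]) ->
  (forall s t, (0 < s <= d)%N -> (0 < t)%N -> coprime s t -> G s t = F s t) ->
  forall s t, (0 < s)%N -> (0 < t)%N -> coprime s t -> G s t = F s t.
Proof.
move=> Gsym Fsym Gpoly Fpoly base.
have step s xs : (0 < s)%N -> uniq xs -> size xs = d ->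
    (forall x, x \in xs -> [/\ (0 < x)%N, coprime s x & G s x = F s x]) ->
    forall t, (0 < t)%N -> coprime s t -> G s t = F s t.
  move=> s0 u sx hx t t0 co.
  have [g sg hg] := Gpoly s s0; have [h sh hh] := Fpoly s.
  rewrite hg // hh (@poly_eq_nat g h xs) ?sx // => x /hx[x0 cx e].
  by rewrite -hg // -hh.
(* When [t] is coprime to [d!], the sample points [1, ..., d] are all coprime to [t], and symmetry
   supplies the values there. *)
have big_t s t : (0 < s)%N -> (0 < t)%N -> coprime s t -> coprime t d`! -> G t s = F t s.
  move=> s0 t0 co ct; apply: (step t (iota 1 d)) => //; rewrite ?iota_uniq ?size_iota //;
    last by rewrite coprime_sym.
  move=> x; rewrite mem_iota => /andP[x1 xd].
  have cx : coprime t x by apply: coprime_dvdr ct; apply: dvdn_fact; lia.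
  by split=> //; rewrite Gsym Fsym; apply: base => //; [lia | rewrite coprime_sym].
move=> s t s0 t0 co.
(* The sample points [k * d! * s + 1] are coprime to [s] and to [d!], so [big_t] applies at each of
   them. *)
apply: (step s [seq (k * (d`! * s)).+1 | k <- iota 1 d]) => //.
- rewrite map_inj_uniq ?iota_uniq // => i j [] /eqP.
  by rewrite eqn_pmul2r ?muln_gt0 ?fact_gt0 // => /eqP.
- by rewrite size_map size_iota.
move=> _ /mapP[k _ ->].
have c : coprime (k * (d`! * s)).+1 (d`! * s).
  by rewrite coprime_sym /coprime -addn1 gcdnMDl gcdn1.
have [c1 c2] : coprime (k * (d`! * s)).+1 d`! /\ coprime (k * (d`! * s)).+1 s.
  by split; apply: coprime_dvdr c; [apply: dvdn_mulr | apply: dvdn_mull].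
split=> //; first by rewrite coprime_sym.
by rewrite Gsym Fsym; apply: big_t => //; rewrite coprime_sym.
Qed.

(** * Enumeration in binary integers *)

Local Notation "x +z y" := (BinInt.Z.add x y) (at level 50, left associativity).
Local Notation "x -z y" := (BinInt.Z.sub x y) (at level 50, left associativity).
Local Notation "x *z y" := (BinInt.Z.mul x y) (at level 40, left associativity).
Local Notation Zn := BinInt.Z.of_nat.
Local Notation Z := BinNums.Z.
Local Notation Z0 := BinNums.Z0.

Section Enumeration.

Definition ratZ (x : Z) : rat := (ssrZ.int_of_Z x)%:~R.

Lemma ratZD x y : ratZ (x +z y) = ratZ x + ratZ y.
Proof. by rewrite /ratZ -rmorphD; congr (_%:~R); lia. Qed.

Lemma ratZB x y : ratZ (x -z y) = ratZ x - ratZ y.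
Proof. by rewrite /ratZ -rmorphB; congr (_%:~R); lia. Qed.

Lemma ratZM x y : ratZ (x *z y) = ratZ x * ratZ y.
Proof. by rewrite /ratZ -rmorphM; congr (_%:~R); lia. Qed.

Lemma ratZ_nat n : ratZ (Zn n) = n%:R.
Proof. by rewrite /ratZ [RHS]pmulrn; congr (_%:~R); lia. Qed.

Definition ratZE := (ratZD, ratZB, ratZM, ratZ_nat).

Variables (s t : nat) (g : Z -> Z -> Z) (g' : rat -> rat -> rat).
Hypothesis gE : forall x y, ratZ (g x y) = g' (ratZ x) (ratZ y).

(** Depth-first enumeration of the sequences of length [n] and sum [r] without building them: [cur]
    is the current level, [A1] and [A2] accumulate the levels and their squares, and [g] is
    evaluated at the leaves. *)
Fixpoint walk_sum (n r : nat) (cur A1 A2 : Z) : Z :=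
  if n is n'.+1 then
    foldr (fun k x => walk_sum n' (r - k) (cur +z Zn t -z Zn s *z Zn k)
             (A1 +z cur) (A2 +z cur *z cur) +z x) Z0 (iota 0 r.+1)
  else if r is 0 then g A1 A2 else Z0.

Lemma walk_sumS n r cur A1 A2 :
  walk_sum n.+1 r cur A1 A2 =
    foldr (fun k x => walk_sum n (r - k) (cur +z Zn t -z Zn s *z Zn k)
             (A1 +z cur) (A2 +z cur *z cur) +z x) Z0 (iota 0 r.+1).
Proof. by []. Qed.

Lemma walk_sumE n r cur A1 A2 :
  ratZ (walk_sum n r cur A1 A2) =
  \sum_(z <- comps n r)
    g' (ratZ A1 + \sum_(0 <= j < n) (ratZ cur + j%:R * t%:R - s%:R * (psum z j)%:R))
       (ratZ A2 + \sum_(0 <= j < n) (ratZ cur + j%:R * t%:R - s%:R * (psum z j)%:R) ^+ 2).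
Proof.
elim: n r cur A1 A2 => [|n IH] r cur A1 A2.
  by case: r => [|r] /=; rewrite ?big_nil // big_seq1 !big_nil !addr0 gE.
rewrite compsS big_allpairs_dep walk_sumS.
elim: (iota 0 r.+1) => [|k ks IHks]; first by rewrite big_nil.
rewrite big_cons /= ratZD IHks IH; congr (_ + _).
apply: eq_bigr => z _; rewrite !ratZE !big_nat_recl //= /psum take0 /=.
have E (j : nat) : ratZ cur + t%:R - s%:R * k%:R + j%:R * t%:R - s%:R * (sumn (take j z))%:R
    = ratZ cur + j.+1%:R * t%:R - s%:R * (k + sumn (take j z))%N%:R :> rat.
  by rewrite natrD -[j.+1]addn1 natrD !mulrDl !mulrDr mul1r opprD !addrA; ring.
have E0 : ratZ cur + 0%:R * t%:R - s%:R * 0%:R = ratZ cur by ring.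
rewrite E0 -expr2 -[X in g' X _]addrA -[X in g' _ X]addrA.
by congr (g' (_ + (_ + _)) (_ + (_ + _))); apply: eq_bigr => j _; rewrite E.
Qed.

End Enumeration.

(** * Reduction of expectations to finitely many sums *)

Lemma st_coresC s t : st_cores s t = st_cores t s.
Proof. by apply/seteqP; split=> la [? ? ?]; split. Qed.

Lemma size_comps_neq0 s t : (0 < s)%N -> (size (comps s t))%:R != 0 :> rat.
Proof. by case: s => // s _; rewrite size_comps pnatr_eq0 -lt0n bin_gt0 leq_addl. Qed.

(** The average over all sequences is polynomial in [t] for every [t], and agrees with the
    expectation over cores when [s] and [t] are coprime. The values to check may therefore include
    [t = 0] and [t] not coprime to [s]. *)
Lemma unif_expect_interpolation d (X : nat -> nat -> rat -> rat) (F : nat -> nat -> rat) :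
  (forall s t x, X s t x = X t s x) -> (forall s t, F s t = F t s) ->
  (forall s, raises s d (fun z => X s (sumn z) (qsize z))) ->
  (forall s, exists2 h : {poly rat}, (size h <= d.+1)%N & forall t, F s t = h.[t%:R]) ->
  (forall s t, (0 < s <= d.+1)%N -> (t < d.+1)%N ->
     \sum_(z <- comps s t) X s t (qsize z) = (size (comps s t))%:R * F s t) ->
  forall s t, (0 < s)%N -> (0 < t)%N -> coprime s t ->
    unif_expect (st_cores s t) (fun la => X s t (part_size la)) = F s t.
Proof.
move=> Xsym Fsym Xr Fpoly check.
have Gpoly s : (0 < s)%N -> exists2 g : {poly rat}, (size g <= d.+1)%N &
    forall t, \sum_(z <- comps s t) X s t (qsize z) = (size (comps s t))%:R * g.[t%:R].
  case: s => // s _; have [g sg hg] := raises_avg (Xr s.+1); exists g => // t.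
  rewrite -hg !big_seq; apply: eq_bigr => z.
  by rewrite mem_comps => /andP[_ /eqP ->].
have Gval s t (g : {poly rat}) : (0 < s)%N -> (0 < t)%N -> coprime s t ->
    \sum_(z <- comps s t) X s t (qsize z) = (size (comps s t))%:R * g.[t%:R] ->
    unif_expect (st_cores s t) (fun la => X s t (part_size la)) = g.[t%:R].
  move=> s0 t0 co e; rewrite unif_expect_st_cores // e mulrAC divff ?mul1r //.
  exact: size_comps_neq0.
apply: (@symmetric_interpolation d.+1) => //.
- move=> s t; rewrite st_coresC; congr unif_expect.
  by apply/funext => la; apply: Xsym.
- move=> s s0; have [g sg hg] := Gpoly s s0; exists g => // t t0 co.
  exact: Gval.
- move=> s t /andP[s0 sd] t0 co.
  have [g sg hg] := Gpoly s s0; have [h sh hh] := Fpoly s.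
  rewrite (Gval _ _ g) // hh (@poly_eq_nat g h (iota 0 d.+1)) ?iota_uniq ?size_iota //.
  move=> x; rewrite mem_iota => /andP[_ xd].
  apply: (mulfI (size_comps_neq0 x s0)).
  by rewrite -hg -hh check // s0.
Qed.

(* [24 * s ^ 2] times the deviation of the size from its mean, where [A1] and [A2]
   are the sum of the levels and the sum of their squares. *)
Definition deviationZ (s t A1 A2 : Z) : Z :=
  Zn 12 *z (s *z A2 -z A1 *z A1) -z s *z s *z (s *z s -z Zn 1)
  -z s *z s *z (s -z Zn 1) *z (t -z Zn 1) *z (s +z t +z Zn 1).

Definition numeratorZ (s t : Z) : Z :=
  let s2 := s *z s in let t2 := t *z t in
  s *z t *z (t -z Zn 1) *z (s -z Zn 1) *z (s +z t +z Zn 1) *z (s +z t) *z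
  (Zn 19 *z s2 *z s2 *z t2 +z Zn 38 *z s2 *z s *z t2 *z t +z Zn 19 *z s2 *z t2 *z t2
   -z Zn 51 *z s2 *z s2 *z t -z Zn 102 *z s2 *z s *z t2 -z Zn 102 *z s2 *z t2 *z t
   -z Zn 51 *z s *z t2 *z t2
   +z Zn 36 *z s2 *z s2 +z Zn 72 *z s2 *z s *z t +z Zn 108 *z s2 *z t2
   +z Zn 72 *z s *z t2 *z t +z Zn 36 *z t2 *z t2
   -z Zn 33 *z s2 *z t -z Zn 33 *z s *z t2
   +z Zn 36 *z s2 +z Zn 36 *z s *z t +z Zn 36 *z t2 +z Zn 120).

Definition check_mean (s t : nat) : bool :=
  BinInt.Z.eqb (walk_sum s t (deviationZ (Zn s) (Zn t))
    s t Z0 Z0 Z0) Z0.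

(** Here [c] is the scale of [deviationZ] and [den] the denominator of the moment, so that the whole
    test is an identity between integers. *)
Definition check_moment4 (s t : nat) : bool :=
  let c := Zn 24 *z Zn s *z Zn s in
  let num := c *z c *z c *z c *z numeratorZ (Zn s) (Zn t) in
  let den := Zn 2016 *z Zn 2400 in
  BinInt.Z.eqb (walk_sum s t
    (fun A1 A2 => let x := deviationZ (Zn s) (Zn t) A1 A2 in
       let x2 := x *z x in den *z (x2 *z x2) -z num)
    s t Z0 Z0 Z0) Z0.

(** The size has degree 2 in the entries, so three values of each variable suffice. *)
Lemma check_mean_all :
  all (fun s => all (check_mean s) (iota 0 3)) (iota 1 3).
Proof. by vm_compute. Qed.

(** The fourth power of a quadratic deviation has degree 8, so nine values of each variable
    suffice. *)
Lemma check_moment4_all :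
  all (fun s => all (check_moment4 s) (iota 0 9)) (iota 1 9).
Proof. by vm_compute. Qed.

Lemma ratZ_deviation (s t : nat) A1 A2 : (0 < s)%N ->
  ratZ (deviationZ (Zn s) (Zn t) A1 A2) =
  24 * s%:R ^+ 2 *
  ((s%:R * ratZ A2 - ratZ A1 ^+ 2) / (2 * s%:R ^+ 2) - (s%:R ^+ 2 - 1) / 24
   - mean s%:R t%:R).
Proof.
move=> s0; have n0 : s%:R != 0 :> rat by rewrite pnatr_eq0 -lt0n.
by rewrite /deviationZ /mean !ratZE; field.
Qed.

Lemma walk_sum_deviation (s t : nat) (g : Z -> Z) (g' : rat -> rat) :
  (0 < s)%N -> (forall x, ratZ (g x) = g' (ratZ x)) ->
  ratZ (walk_sum s t
    (fun A1 A2 => g (deviationZ (Zn s) (Zn t) A1 A2))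
    s t Z0 Z0 Z0) =
  \sum_(z <- comps s t) g' (24 * s%:R ^+ 2 * (qsize z - mean s%:R t%:R)).
Proof.
move=> s0 gE.
rewrite (@walk_sumE _ _ _ (fun A1 A2 => g' (24 * s%:R ^+ 2 *
  ((s%:R * A2 - A1 ^+ 2) / (2 * s%:R ^+ 2) - (s%:R ^+ 2 - 1) / 24
   - mean s%:R t%:R)))); last by move=> x y; rewrite gE ratZ_deviation.
rewrite !big_seq; apply: eq_bigr => z; rewrite mem_comps => /andP[/eqP hs /eqP ht].
have E j : 0 + j%:R * t%:R - s%:R * (psum z j)%:R = rlevel z j.
  by rewrite /rlevel hs ht add0r.
rewrite (_ : ratZ Z0 = 0) // /qsize hs.
have -> : \sum_(0 <= j < s) (0 + j%:R * t%:R - s%:R * (psum z j)%:R) =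
    \sum_(0 <= j < s) rlevel z j by apply: eq_bigr.
have -> : \sum_(0 <= j < s) (0 + j%:R * t%:R - s%:R * (psum z j)%:R) ^+ 2 =
    \sum_(0 <= j < s) rlevel z j ^+ 2 by apply: eq_bigr => j _; rewrite E.
by rewrite 2!add0r.
Qed.

Lemma sum_cst_seq (T : Type) (r : seq T) (c : rat) :
  \sum_(x <- r) c = (size r)%:R * c.
Proof. by rewrite big_const_seq count_predT iter_addr_0 mulr_natl. Qed.

Lemma check_meanP (s t : nat) : (0 < s)%N -> check_mean s t ->
  \sum_(z <- comps s t) qsize z = (size (comps s t))%:R * mean s%:R t%:R.
Proof.
move=> s0 /BinInt.Z.eqb_spec e.
have := @walk_sum_deviation s t id id s0 (fun=> erefl); rewrite e -mulr_sumr sumrB.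
have n0 : 24 * s%:R ^+ 2 != 0 :> rat by rewrite mulf_neq0 // expf_neq0 // pnatr_eq0 -lt0n.
move/esym/eqP; rewrite mulf_eq0 (negbTE n0) /= subr_eq0 => /eqP ->.
by rewrite sum_cst_seq.
Qed.

Lemma natr_mul_neq0 (m n : nat) : (0 < m)%N -> (0 < n)%N -> m%:R * n%:R != 0 :> rat.
Proof. by move=> m0 n0; rewrite -natrM pnatr_eq0 -lt0n muln_gt0 m0. Qed.

Lemma ratZ_mul_nat (m n : nat) :
  ratZ (Zn m *z Zn n) = m%:R * n%:R.
Proof. by rewrite ratZM !ratZ_nat. Qed.

Lemma mulr_div1K (d x : rat) : d != 0 -> d * (1 / d * x) = x.
Proof. by move=> d0; rewrite mulrA div1r mulfV // mul1r. Qed.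

Lemma den4_neq0 : 2016 * 2400 != 0 :> rat.
Proof. exact: (@natr_mul_neq0 2016 2400 isT isT). Qed.

Lemma ratZ_numerator (s t : nat) :
  ratZ (numeratorZ (Zn s) (Zn t)) =
  2016 * 2400 * moment4_formula s%:R t%:R.
Proof.
rewrite /moment4_formula; apply: etrans (esym (mulr_div1K _ den4_neq0)).
by rewrite /numeratorZ !ratZE /P4; ring.
Qed.

Lemma sum_exp4_scaled (T : Type) (r : seq T) (f : T -> rat) (c den m : rat) :
  c != 0 -> den != 0 ->
  0 = \sum_(x <- r) (den * (c * f x) ^+ 4 - c ^+ 4 * (den * m)) ->
  \sum_(x <- r) f x ^+ 4 = (size r)%:R * m.
Proof.
move=> c0 den0 h; have n0 : c ^+ 4 * den != 0 by rewrite mulf_neq0 // expf_neq0.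
apply: (mulfI n0); apply/eqP; rewrite -subr_eq0 [eqbRHS]h; apply/eqP.
rewrite sumrB sum_cst_seq mulr_sumr; congr (_ - _); last by ring.
by apply: eq_bigr => x _; rewrite -mulrA mulrCA -exprMn.
Qed.

Lemma walk_sum_moment4 (s t : nat) (denZ numZ : Z) (den m : rat) :
  (0 < s)%N -> ratZ denZ = den -> den != 0 ->
  ratZ numZ = (24 * s%:R ^+ 2) ^+ 4 * (den * m) ->
  walk_sum s t (fun A1 A2 =>
      let x := deviationZ (Zn s) (Zn t) A1 A2 in
      let x2 := x *z x in denZ *z (x2 *z x2) -z numZ)
    s t Z0 Z0 Z0 = Z0 ->
  \sum_(z <- comps s t) (qsize z - mean s%:R t%:R) ^+ 4 = (size (comps s t))%:R * m.
Proof.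
move=> s0 denE den0 numE e.
pose g x := denZ *z (x *z x *z (x *z x)) -z numZ.
pose g' x := den * x ^+ 4 - (24 * s%:R ^+ 2) ^+ 4 * (den * m).
have gE x : ratZ (g x) = g' (ratZ x).
  rewrite /g /g' ratZB numE ratZM denE; congr (_ * _ - _).
  by rewrite !ratZM !exprS expr0 mulr1 !mulrA.
have c0 : 24 * s%:R ^+ 2 != 0 :> rat.
  by apply: mulf_neq0 => //; rewrite expf_neq0 // pnatr_eq0 -lt0n.
apply: (sum_exp4_scaled c0 den0).
by rewrite -[LHS](congr1 ratZ e) (walk_sum_deviation t s0 gE).
Qed.

Lemma check_moment4P (s t : nat) : (0 < s)%N -> check_moment4 s t ->
  \sum_(z <- comps s t) (qsize z - mean s%:R t%:R) ^+ 4 =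
  (size (comps s t))%:R * moment4_formula s%:R t%:R.
Proof.
move=> s0 /BinInt.Z.eqb_spec.
apply: (walk_sum_moment4 s0 (ratZ_mul_nat 2016 2400) den4_neq0).
rewrite ratZM ratZ_numerator; congr (_ * _).
by rewrite !ratZM !ratZ_nat; ring.
Qed.

(** * The mean and the fourth moment *)

Lemma raises_mean s : raises s 2 (fun z => mean s%:R (sumn z)%:R).
Proof.
have h1 : raises s 1 (fun z => (s%:R - 1) / 24 * ((sumn z)%:R - 1)).
  exact/raises_scale/raises_sub/raises_cst/raises_sumn.
have h2 : raises s 1 (fun z => (sumn z)%:R + (s%:R + 1)).
  exact/raises_add/raises_cst/raises_sumn.
by apply: raises_ext (raises_mul h1 h2) => z _; rewrite /mean; ring.
Qed.

Lemma mean_poly s : exists2 h : {poly rat}, (size h <= 3)%N &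
  forall t : nat, mean s%:R t%:R = h.[t%:R].
Proof.
pose c : rat := (s%:R - 1) / 24.
exists (Poly [:: - c * (s%:R + 1); c * s%:R; c]); first exact: size_Poly.
by move=> t; rewrite horner_Poly /= /mean /c; ring.
Qed.

Lemma moment4_poly s : exists2 h : {poly rat}, (size h <= 9)%N &
  forall t : nat, moment4_formula s%:R t%:R = h.[t%:R].
Proof.
pose x : rat := s%:R.
(* Coefficients in [t], constant term first: [A] is [t (t - 1) (x + t + 1) (x + t)] and [B] is
   [P4 x t]. Each has degree at most 4, so the product has at most 9 coefficients. *)
pose A := Poly [:: 0; - x * (x + 1); x ^+ 2 - x - 1; 2 * x; 1].
pose B := Poly [:: 36 * x ^+ 4 + 36 * x ^+ 2 + 120;
  - 51 * x ^+ 4 + 72 * x ^+ 3 - 33 * x ^+ 2 + 36 * x;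
  19 * x ^+ 4 - 102 * x ^+ 3 + 108 * x ^+ 2 - 33 * x + 36;
  38 * x ^+ 3 - 102 * x ^+ 2 + 72 * x; 19 * x ^+ 2 - 51 * x + 36].
exists ((1 / (2016 * 2400) * x * (x - 1)) *: (A * B)).
  apply: leq_trans (size_scale_leq _ _) _; apply: leq_trans (size_polyMleq _ _) _.
  have hA : (size A <= 5)%N by apply: size_Poly.
  have hB : (size B <= 5)%N by apply: size_Poly.
  by rewrite -subn1 leq_subLR; apply: (leq_add hA hB).
move=> t; rewrite hornerZ hornerM.
have -> : A.[t%:R] = t%:R * (t%:R - 1) * (x + t%:R + 1) * (x + t%:R).
  by rewrite /A horner_Poly /=; ring.
have -> : B.[t%:R] = P4 x t%:R by rewrite /B horner_Poly /= /P4; ring.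
have E (k y a b c d p : rat) :
    k * (x * y * a * b * c * d * p) = k * x * b * (y * a * c * d * p).
  by ring.
exact: E.
Qed.

(** The explicit mean comes first, since it turns the central moment into the expectation of a
    polynomial in the size, [s] and [t]. *)
Lemma mean_st_cores s t : (0 < s)%N -> (0 < t)%N -> coprime s t ->
  unif_expect (st_cores s t) part_size = mean s%:R t%:R.
Proof.
apply: (@unif_expect_interpolation 2 (fun _ _ x => x) (fun s t => mean s%:R t%:R)) => //.
- by move=> {}s {}t; rewrite /mean; ring.
- exact: raises_qsize.
- exact: mean_poly.
move=> {}s {}t /andP[s0 s3] t3; apply: check_meanP => //.
move/allP: check_mean_all => /(_ s) /[!mem_iota] /(_ _)/allP.
by apply; rewrite ?mem_iota // s0.
Qed.

Theorem theorem4 (s t : nat) (s_gt0 : (0 < s)%N) (t_gt0 : (0 < t)%N)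
    (co_st : coprime s t) :
  finite_set (st_cores s t) /\
  central_moment (st_cores s t) 4 part_size = moment4_formula s%:R t%:R.
Proof.
split; first exact: finite_st_cores.
rewrite /central_moment (mean_st_cores s_gt0 t_gt0 co_st).
move: s t s_gt0 t_gt0 co_st.
apply: (@unif_expect_interpolation 8 (fun s t x => (x - mean s%:R t%:R) ^+ 4)
  (fun s t => moment4_formula s%:R t%:R)).
- by move=> s t x; congr ((_ - _) ^+ _); rewrite /mean; ring.
- move=> s t; rewrite /moment4_formula; congr (_ * _).
  by rewrite /P4; ring.
- by move=> s; apply: (raises_exp 4 (raises_sub (@raises_qsize s) (@raises_mean s))).
- exact: moment4_poly.
move=> s t /andP[s0 s9] t9; apply: check_moment4P => //.
move/allP: check_moment4_all => /(_ s) /[!mem_iota] /(_ _)/allP.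
by apply; rewrite ?mem_iota // s0.
Qed.
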